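(* Let $S$ be a semigroup with left cancellation law, let $P_1$ be a completely prime (two-sided) ideal of $S$ such that $S$ is right $P_1$-comparable, and let $P_2\subset P_1$ be a prime segment of $S$. Then exactly one of the following alternatives occurs: (i) The prime segment $P_2\subset P_1$ is Archimedean. (ii) The prime segment $P_2\subset P_1$ is simple, i.e. there are no further ideals between $P_1$ and $P_2$. (iii) There exists a prime ideal $Q$ with $P_2\subset Q\subset P_1$ such that no further ideal between $P_1$ and $Q$ exists. Moreover, $P_2=\bigcap_{n\in\mathbb N}Q^n$.
   Context: ''Semigroup'' means a (not necessarily commutative) semigroup $S$ with unit element $1$ and zero element $0$, $1\neq 0$. ''Ideal'' means two-sided ideal; $\subset$ denotes proper inclusion; products of subsets are sets of elementwise products ($AB=\{ab: a\in A, b\in B\}$), and $I^n$ is the corresponding power. $S$ has left cancellation law if for all $a,b,c\in S$, $ab=ac\neq 0$ implies $b=c$. A proper right ideal (in particular, a proper ideal) $P$ is prime if for all $a,b\in S$, $aSb\subseteq P$ implies $a\in P$ or $b\in P$; it is completely prime if $ab\in P$ implies $a\in P$ or $b\in P$. For a completely prime ideal $P$ put $T=S-P$ (set difference), and for $a\in S$ put $(aS)T^{-1}=\{x\in S: xt\in aS\text{ for some }t\in T\}$. $S$ is right $P$-comparable if for all $a,b\in S$ one of the following holds: $aS\subseteq bS$, $bS\subseteq aS$, or $(aS)T^{-1}=(bS)T^{-1}$. Prime segment: if $P_2\subset P_1$ are completely prime ideals of $S$ with no further completely prime ideals between them, then $P_2\subset P_1$ is called a prime segment of $S$; if $P_1$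 is the minimal completely prime ideal of $S$, then $\varnothing\subset P_1$ is also considered a prime segment. A prime segment $P_2\subset P_1$ is Archimedean if for every $a\in P_1-P_2$ there exists an ideal $I\subseteq P_1$ with $a\in I$ and $P_2=\bigcap_{n\in\mathbb N} I^n$. It is simple if there are no further two-sided ideals of $S$ strictly between $P_2$ and $P_1$.
   Formalization: For a prime segment ∅ ⊂ P1 it is additionally assumed that P1 = {0}: every ideal contains 0, so otherwise none of (i)–(iii) holds (e.g. S = {1, x, 0}, x² = 0, P1 = {x, 0}). *)

(* Defs.v *)
From HB Require Import structures.
From mathcomp Require Import all_boot.
From mathcomp Require Import all_classical.

Set Implicit Arguments.
Unset Strict Implicit.
Unset Printing Implicit Defensive.

Local Open Scope group_scope.
Local Open Scope classical_set_scope.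

HB.mixin Record Monoid_hasZero S of Monoid S := {
  szero : S;
  mul0s : left_zero szero (@mul S);
  muls0 : right_zero szero (@mul S);
  one_neq_zero : 1%g <> szero :> S
}.

#[short(type="monoid0Type")]
HB.structure Definition Monoid0 := {S of Monoid_hasZero S & Monoid S}.

Section Monoid0.
Context {S : monoid0Type}.
Implicit Types (a b c : S) (A B I P Q : set S).

Definition left_cancellative : Prop :=
  forall a b c, a * b = a * c -> a * b <> szero -> b = c.

Definition set_mul A B : set S := [set a * b | a in A & b in B].

(* A ^ 0 is S by convention; A ^ n = A ... A (n factors) for n > 0. *)
Definition set_pow A n : set S := iterop n set_mul A setT.

(* The index set of the intersection is {1, 2, ...}. *)
Definition set_pow_omega A : set S := \bigcap_n set_pow A n.+1.

Definition right_principal a : set S := [set a * s | s in setT].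

(* Ideals are nonempty, so they contain the zero element. *)
Definition ideal I : Prop :=
  I !=set0 /\ forall x s, I x -> I (s * x) /\ I (x * s).

Definition proper_ideal I : Prop := ideal I /\ I `<` setT.

Definition prime_ideal P : Prop :=
  proper_ideal P /\
  forall a b, [set a * s * b | s in setT] `<=` P -> P a \/ P b.

Definition completely_prime_ideal P : Prop :=
  proper_ideal P /\ forall a b, P (a * b) -> P a \/ P b.

(* (aS)T^-1, where T is the complement of P. *)
Definition right_fractions P a : set S :=
  [set x | exists2 t, (~` P) t & right_principal a (x * t)].

Definition right_comparable P : Prop :=
  forall a b,
    [\/ right_principal a `<=` right_principal b,
        right_principal b `<=` right_principal a
      | right_fractions P a = right_fractions P b].

Definition no_ideal_between Q P : Prop :=
  ~ exists I, [/\ ideal I, Q `<` I & I `<` P].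

(* In the second case P1 is a minimal completely prime ideal.  As set0 is not
   an ideal, and set0 `<` Q always holds for an ideal Q, that case says that no
   completely prime ideal lies between set0 and P1.
   Pitfall: every ideal contains szero, hence so do all its powers.  So a
   segment with P2 = set0 is never Archimedean nor exceptional (as defined
   below), and it is simple only when P1 = [set szero]. *)
Definition prime_segment P2 P1 : Prop :=
  [/\ completely_prime_ideal P2, completely_prime_ideal P1, P2 `<` P1
    & ~ exists Q, [/\ completely_prime_ideal Q, P2 `<` Q & Q `<` P1]]
  \/
  [/\ P2 = set0, completely_prime_ideal P1
    & ~ exists Q, completely_prime_ideal Q /\ Q `<` P1].

Definition archimedean_segment P2 P1 : Prop :=
  forall a, (P1 `\` P2) a ->
    exists I, [/\ ideal I, I `<=` P1, I a & P2 = set_pow_omega I].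

Definition simple_segment P2 P1 : Prop := no_ideal_between P2 P1.

Definition exceptional_segment P2 P1 : Prop :=
  exists Q, [/\ prime_ideal Q, P2 `<` Q, Q `<` P1, no_ideal_between Q P1
              & P2 = set_pow_omega Q].

End Monoid0.

Arguments left_cancellative S : clear implicits.

Definition exactly_one (A B C : Prop) : Prop :=
  [\/ [/\ A, ~ B & ~ C], [/\ ~ A, B & ~ C] | [/\ ~ A, ~ B & C]].

(* Main.v *)
(** Let T be the complement of P1.  Comparability gives P1 = tP1 for every t in
    T, and for a non-nilpotent ideal I inside P1 it makes the complement of
    J = \bigcap_n I^n well behaved: a \notin J implies I^n \subseteq aS for some
    n.  Then J is completely prime: if ab \in J with a, b \notin J, some power
    of I lies in abS, so J = abS is idempotent and left cancellation puts 1 in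
    J.  Consequently, an ideal I inside P1 but not inside P2 satisfies either
    \bigcap_n I^n = P2 or I = P1 = P1^2.  If the segment is not Archimedean,
    some a in P1 generates P1 as an ideal and P1 = P1^2, so the union Q of all
    ideals properly contained in P1 is a prime ideal other than P1; the
    segment is simple if Q = P2 and exceptional otherwise. *)
Require Import Defs.
From HB Require Import structures.
From mathcomp Require Import all_boot.
From mathcomp Require Import all_classical.

Set Implicit Arguments.
Unset Strict Implicit.
Unset Printing Implicit Defensive.

Local Open Scope classical_set_scope.

(** * Ideals, their products and powers *)

Section Ideals.
Local Open Scope group_scope.
Context {S : monoid0Type}.
Implicit Types (a b c x y s t u : S) (A B I J P Q : set S).

Lemma ideal_mulL I s x : ideal I -> I x -> I (s * x).
Proof. by case=> _ II /II - /(_ s) []. Qed.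

Lemma ideal_mulR I s x : ideal I -> I x -> I (x * s).
Proof. by case=> _ II /II - /(_ s) []. Qed.

Lemma right_principalP a x : right_principal a x <-> exists s, x = a * s.
Proof. by split=> [[s _ <-]|[s ->]]; exists s. Qed.

Lemma right_principal_id a : right_principal a a.
Proof. by apply/right_principalP; exists 1; rewrite mulg1. Qed.

Lemma right_principal_sub_ideal I a :
  ideal I -> I a -> right_principal a `<=` I.
Proof. by move=> iI Ia _ [s _ <-]; apply: ideal_mulR. Qed.

Lemma ideal_set_mul A B : ideal A -> ideal B -> ideal (set_mul A B).
Proof.
move=> iA iB; split.
  case: (iA) (iB) => [[x Ax] _] [[y By] _].
  by exists (x * y), x => //; exists y.
move=> _ s [x Ax [y By <-]]; split.
  by exists (s * x); [exact: ideal_mulL | exists y; rewrite ?mulgA].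
by exists x => //; exists (y * s); [exact: ideal_mulR | rewrite mulgA].
Qed.

Lemma set_mul_subl A B : ideal A -> set_mul A B `<=` A.
Proof. by move=> iA _ [x Ax [y _ <-]]; apply: ideal_mulR. Qed.

Lemma set_mulA A B C : set_mul A (set_mul B C) = set_mul (set_mul A B) C.
Proof.
apply/seteqP; split=> [_ [x Ax [_ [y By [z Cz <-]] <-]]|].
  by exists (x * y); [exists x => //; exists y | exists z; rewrite ?mulgA].
move=> _ [_ [x Ax [y By <-]] [z Cz <-]].
by exists x => //; exists (y * z); [exists y => //; exists z | rewrite mulgA].
Qed.

Lemma set_powSS A n : set_pow A n.+2 = set_mul A (set_pow A n.+1).
Proof. by []. Qed.

Lemma set_powD A m n :
  set_pow A (m.+1 + n.+1) = set_mul (set_pow A m.+1) (set_pow A n.+1).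
Proof.
elim: m => // m IHm.
by rewrite set_powSS -set_mulA -IHm !addSn set_powSS.
Qed.

Lemma ideal_set_pow I n : ideal I -> ideal (set_pow I n.+1).
Proof. by move=> iI; elim: n => // n IHn; apply: ideal_set_mul. Qed.

Lemma set_pow_idem I n : set_mul I I = I -> set_pow I n.+1 = I.
Proof. by move=> II; elim: n => // n IHn; rewrite set_powSS IHn. Qed.

Lemma ideal_szero I : ideal I -> I szero.
Proof.
by move=> iI; case: (iI) => [[x Ix] _]; rewrite -(mul0s x); apply: ideal_mulL.
Qed.

Lemma ideal_set_pow_omega I : ideal I -> ideal (set_pow_omega I).
Proof.
move=> iI; split=> [|x s Jx].
  by exists szero => n _; apply: ideal_szero; apply: ideal_set_pow.
by split=> n _; [apply: ideal_mulL (Jx n Logic.I) | apply: ideal_mulR (Jx n Logic.I)];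
  apply: ideal_set_pow.
Qed.

Lemma proper_ideal_one P : proper_ideal P -> ~ P 1.
Proof.
move=> [iP [_ nTP]] P1; apply: nTP => x _.
by rewrite -(mulg1 x); apply: ideal_mulL.
Qed.

Lemma sub_proper_ideal I P : ideal I -> I `<=` P -> proper_ideal P -> proper_ideal I.
Proof.
move=> iI IP pP; split=> //; split=> // TI.
by apply: (proper_ideal_one pP); apply/IP/TI.
Qed.

Lemma completely_prime_ideal_prime P :
  completely_prime_ideal P -> prime_ideal P.
Proof.
move=> [pP cP]; split=> // a b abP; apply: cP.
by apply: abP; exists 1; rewrite ?mulg1.
Qed.

(** Powers of an element outside [P] stay outside [P]. *)
Lemma completely_prime_set_pow I P n :
  completely_prime_ideal P -> set_pow I n.+1 `<=` P -> I `<=` P.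
Proof.
move=> [_ cP] IP x Ix; apply: contrapT => nPx.
have [y Iy nPy] : exists2 y, set_pow I n.+1 y & ~ P y.
  elim: {IP} n => [|n [y Iy nPy]]; first by exists x.
  by exists (x * y); [exists x => //; exists y | case/cP].
exact/nPy/IP.
Qed.

Definition principal_ideal a : set S :=
  [set x | exists s t, x = s * a * t].

Lemma ideal_principal_ideal a : ideal (principal_ideal a).
Proof.
split; first by exists a, 1, 1; rewrite mul1g mulg1.
move=> _ s [u [v ->]]; split; first by exists (s * u), v; rewrite !mulgA.
by exists u, (v * s); rewrite !mulgA.
Qed.

Lemma principal_ideal_id a : principal_ideal a a.
Proof. by exists 1, 1; rewrite mul1g mulg1. Qed.

Lemma principal_ideal_sub I a : ideal I -> I a -> principal_ideal a `<=` I.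
Proof. by move=> iI Ia _ [s [t ->]]; apply: ideal_mulR => //; apply: ideal_mulL. Qed.

End Ideals.

(** * Divisibility under right comparability *)

Section Comparable.
Local Open Scope group_scope.
Context {S : monoid0Type} (P1 : set S).
Hypothesis hcancel : left_cancellative S.
Hypothesis hP1 : completely_prime_ideal P1.
Hypothesis hcomp : right_comparable P1.
Implicit Types (a b c x y s t u : S) (A B I J P Q : set S).

Let iP1 : ideal P1. Proof. by case: hP1 => [[]]. Qed.

Lemma compl_mul s t : ~ P1 s -> ~ P1 t -> ~ P1 (s * t).
Proof. by case: hP1 => _ cP ns nt /cP []. Qed.

(** As [1] lies outside [P1], each element is in its own [right_fractions]; equal fraction sets thus
    give denominators both ways. *)
Lemma comparable_elements a b :
  [\/ exists s, a = b * s, exists s, b = a * s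
    | (exists t s, ~ P1 t /\ a * t = b * s) /\
      (exists t s, ~ P1 t /\ b * t = a * s)].
Proof.
have n1 : ~ P1 1 by apply: proper_ideal_one; case: hP1.
have frac c : right_fractions P1 c c.
  by exists 1 => //; rewrite mulg1; apply: right_principal_id.
case: (hcomp a b) => [ab|ba|E].
- by apply: Or31; apply/right_principalP/ab/right_principal_id.
- by apply: Or32; apply/right_principalP/ba/right_principal_id.
apply: Or33; split.
  by have := frac a; rewrite E => -[t nt [s _ e]]; exists t, s.
by have := frac b; rewrite -E => -[t nt [s _ e]]; exists t, s.
Qed.

(** Any alternative to [x = t * s] puts [t], or some [t * u] with [u] outside [P1], into [P1]. *)
Lemma compl_divides t x : ~ P1 t -> P1 x -> exists2 y, P1 y & x = t * y.
Proof.
move=> nt Px.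
have [s e] : exists s, x = t * s.
  case: (comparable_elements x t) => [//|[s e]|[_ [u [s [nu e]]]]].
    by case: nt; rewrite e; apply: ideal_mulR.
  by case: (compl_mul nt nu); rewrite e; apply: ideal_mulR.
by exists s => //; move: Px; rewrite e; case: hP1 => _ cP /cP [].
Qed.

(** Any comparison of [u] in [I] with [a] other than [u = a * s] puts some [a * t] with [t] outside
    [P1] into [I]. *)
Lemma ideal_sub_right_principal I a :
  ideal I -> (forall t, ~ P1 t -> ~ I (a * t)) -> I `<=` right_principal a.
Proof.
move=> iI na u Iu; apply/right_principalP.
case: (comparable_elements u a) => [//|[s e]|[_ [t [s [nt e]]]]].
  case: (na 1); first by apply: proper_ideal_one; case: hP1.
  by rewrite mulg1 e; apply: ideal_mulR.
by case: (na t nt); rewrite e; apply: ideal_mulR.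
Qed.

(** For [y] in [P1] outside [Q], every [s * y] is a right multiple of [t], so [x * s * y] lies in
    [Q]; primeness leaves [x] in [Q]. *)
Lemma prime_ideal_compl Q x t :
  prime_ideal Q -> Q `<` P1 -> ~ P1 t -> Q (x * t) -> Q x.
Proof.
move=> [[iQ _] pQ] [_ nP1Q] nt Qxt; have [y [P1y nQy]] : exists y, P1 y /\ ~ Q y.
  by apply/not_existsP => h; apply: nP1Q => y P1y; apply: contrapT => nQy; apply: (h y).
case: (pQ x y) => // _ [s _ <-].
have [z _ e] := compl_divides nt (ideal_mulL s iP1 P1y).
by rewrite -mulgA e mulgA; apply: ideal_mulR.
Qed.

(** For [x] in [I] outside [Q], no [x * t] with [t] outside [P1] is in [Q], so [Q] lies in xS. *)
Lemma prime_ideal_sub Q I :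
  prime_ideal Q -> Q `<` P1 -> ideal I -> ~ I `<=` Q -> Q `<=` I.
Proof.
move=> pQ QP1 iI /existsNP [x /not_implyP [Ix nQx]].
apply: subset_trans (right_principal_sub_ideal iI Ix).
apply: ideal_sub_right_principal => [|t nt Qxt]; first by case: pQ => [[]].
by apply: nQx; apply: prime_ideal_compl Qxt.
Qed.

(** * Powers of a non-nilpotent ideal inside [P1] *)

Section Powers.
Context (I : set S).
Hypothesis iI : ideal I.
Hypothesis IP1 : I `<=` P1.
Hypothesis non_nilpotent : forall n, ~ set_pow I n.+1 `<=` [set szero].

(** Removing [t] costs one factor of [I]. Write [x * t = u * v] with [v] in [I]. If this is nonzero,
    any comparison other than [x = u * s] gives [x * t = x * (s * y)] with [y] in [P1], and
    cancelling [x] puts [t] in [P1]. *)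
Lemma set_pow_compl n x t :
  ~ P1 t -> set_pow I n.+2 (x * t) -> set_pow I n.+1 x.
Proof.
move=> nt; have iIn := ideal_set_pow n iI.
have powS : set_pow I n.+2 = set_mul (set_pow I n.+1) I.
  by rewrite -[n.+2]addn1 set_powD.
rewrite powS => -[u Iu [v Iv e]].
have [xt0|nxt0] := pselect (x * t = szero); last first.
  have absurd s y : P1 y -> x * t <> x * (s * y).
    move=> P1y E; case: nt; rewrite (hcancel E nxt0).
    exact: ideal_mulL.
  case: (comparable_elements x u) => [[s ->]|[s us]|[_ [t' [s [nt' e']]]]].
  - exact: ideal_mulR.
  - by case: (absurd s v (IP1 Iv)); rewrite -e us mulgA.
  - have [y P1y vy] := compl_divides nt' (IP1 Iv).
    by case: (absurd s y P1y); rewrite -e vy !mulgA e'.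
(* If x t = 0, then x P1 = x t P1 = 0; so x \notin I^n forces I^n P1 = 0. *)
apply: contrapT => nIx; apply: (@non_nilpotent n.+1).
rewrite powS => _ [w Iw [z Iz <-]].
have xP1 s y : P1 y -> x * (s * y) = szero.
  move=> P1y; have [y' _ ->] := compl_divides nt (ideal_mulL s iP1 P1y).
  by rewrite mulgA xt0 mul0s.
case: (comparable_elements w x) => [[s ->]|[s xw]|[[t' [s [nt' e']]] _]].
- by rewrite -mulgA; apply/xP1/IP1.
- by case: nIx; rewrite xw; apply: ideal_mulR.
- have [y P1y ->] := compl_divides nt' (IP1 Iz).
  by rewrite mulgA e' -mulgA; apply: xP1.
Qed.

Lemma set_pow_sub_right_principal a :
  ~ set_pow_omega I a -> exists n, set_pow I n.+1 `<=` right_principal a.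
Proof.
(* One power above the one that misses [a], to pay for [set_pow_compl]. *)
move=> /existsNP [n /not_implyP [_ nIa]]; exists n.+1.
apply: ideal_sub_right_principal => [|t nt /(set_pow_compl nt) //].
exact: ideal_set_pow.
Qed.

Lemma completely_prime_set_pow_omega :
  completely_prime_ideal (set_pow_omega I).
Proof.
have JI : set_pow_omega I `<=` I by move=> x /(_ 0%N); apply.
have iJ := ideal_set_pow_omega iI; split.
  by apply: (@sub_proper_ideal _ _ P1) => //; [move=> x /JI /IP1 | case: hP1].
move=> a b Jab; apply: contrapT => /not_orP [].
move=> /set_pow_sub_right_principal [n na].
move=> /set_pow_sub_right_principal [m mb].
set k := (n.+1 + m)%N.
have Kab : set_pow I k.+1 `<=` right_principal (a * b).
  rewrite /k -addnS set_powD => _ [x /na [s _ <-] [y Iy <-]].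
  have [s' _ e] : right_principal b (s * y).
    by apply: mb; apply: ideal_mulL Iy; apply: ideal_set_pow.
  by apply/right_principalP; exists s'; rewrite -!mulgA e.
have nab0 : a * b <> szero.
  move=> ab0; apply: (@non_nilpotent k) => x /Kab [s _ <-].
  by rewrite ab0 mul0s.
(* With K = I^(k+1) inside abS, membership of [a * b] in KK gives [a * b = a * b * s * y] with [y]
   in K. Cancellation yields [s * y = 1], yet [y] lies in abS, hence in [P1]. *)
have : set_pow I (k.+1 + k.+1) (a * b) by apply: Jab.
rewrite set_powD => -[_ /Kab [s _ <-] [y Iy e]].
have e1 : a * b * (s * y) = a * b * 1 by rewrite mulgA e mulg1.
have sy1 : s * y = 1 by apply: hcancel e1 _; rewrite mulgA e.
case: hP1 => /proper_ideal_one + _; apply.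
rewrite -sy1; apply: ideal_mulL iP1 _; apply/IP1/JI.
by apply: right_principal_sub_ideal iJ Jab _ _; apply: Kab.
Qed.

End Powers.

(** * The three alternatives for a segment whose lower end is an ideal *)

Context (P2 : set S).
Hypothesis hP2 : completely_prime_ideal P2.
Hypothesis P21 : P2 `<` P1.
Hypothesis no_between :
  ~ exists Q, [/\ completely_prime_ideal Q, P2 `<` Q & Q `<` P1].

Let iP2 : ideal P2. Proof. by case: hP2 => [[]]. Qed.

(** No power of [I] lies in [P2], so each contains [P2], and so does the completely prime
    [set_pow_omega I]. The segment has no room for it strictly between; if it contains [P1], so do
    [I] and its square. *)
Lemma set_pow_omega_dichotomy I :
  ideal I -> I `<=` P1 -> ~ I `<=` P2 ->
  set_pow_omega I = P2 \/ I = P1 /\ set_mul P1 P1 = P1.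
Proof.
move=> iI IP1 nIP2.
have nilI n : ~ set_pow I n.+1 `<=` [set szero].
  move=> I0; apply/nIP2/(completely_prime_set_pow hP2 (n := n)).
  by move=> x /I0 ->; apply: ideal_szero.
have P2J : P2 `<=` set_pow_omega I.
  move=> x P2x n _; move: x P2x; apply: prime_ideal_sub => //.
  - exact: completely_prime_ideal_prime.
  - exact: ideal_set_pow.
  - by move/(completely_prime_set_pow hP2).
have [JP2|nJP2] := pselect (set_pow_omega I `<=` P2); first by left; apply/seteqP.
have P1J : P1 `<=` set_pow_omega I.
  apply: contrapT => nP1J; apply: no_between; exists (set_pow_omega I).
  split; [exact: completely_prime_set_pow_omega | by [] | split=> //].
  by move=> x /(_ 0%N Logic.I)/IP1.
have IE : I = P1 by apply/seteqP; split=> // x /P1J /(_ 0%N); apply.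
right; split=> //; apply/seteqP; split; first exact: set_mul_subl.
by move=> x /P1J /(_ 1%N Logic.I); rewrite IE.
Qed.

(** Serves both the simple case, with [Q = P2], and the exceptional one. An ideal inside [P1] but
    not inside [Q] is all of [P1]; by primeness of [Q] this applies to the square of [P1], so all
    powers of [P1] equal [P1]. *)
Lemma not_archimedean Q :
  prime_ideal Q -> P2 `<=` Q -> Q `<` P1 -> no_ideal_between Q P1 ->
  ~ archimedean_segment P2 P1.
Proof.
move=> pQ P2Q QP1 nQ arch.
have full I : ideal I -> I `<=` P1 -> ~ I `<=` Q -> I = P1.
  move=> iI IP1 nIQ; apply/seteqP; split=> //.
  apply: contrapT => nP1I; apply: nQ; exists I; split=> //; split=> //.
  exact: prime_ideal_sub.
have /existsNP [a /not_implyP [P1a nQa]] := QP1.2.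
have [|I [iI IP1 Ia P2E]] := arch a; first by split=> // /P2Q.
have IE : I = P1 by apply: full => // /(_ a Ia).
have P11 : set_mul P1 P1 = P1.
  apply: full; [exact: ideal_set_mul | exact: set_mul_subl | move=> P1Q].
  case: pQ => _ /(_ a a) [_ [s _ <-]||] //; apply: P1Q.
  by exists (a * s); [exact: ideal_mulR | exists a].
apply: P21.2; rewrite P2E IE => x P1x n _.
by rewrite set_pow_idem.
Qed.

Lemma exceptional_of_not_simple_not_archimedean :
  ~ simple_segment P2 P1 -> ~ archimedean_segment P2 P1 ->
  exceptional_segment P2 P1.
Proof.
move=> /contrapT [L [iL P2L LP1]] /existsNP [a /not_implyP [[P1a nP2a] noI]].
have full I : ideal I -> I `<=` P1 -> I a -> I = P1 /\ set_mul P1 P1 = P1.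
  move=> iI IP1 Ia; case: (set_pow_omega_dichotomy iI IP1) => [/(_ a Ia)//|E|//].
  by case: noI; exists I.
have P11 : set_mul P1 P1 = P1 by case: (full P1).
(* By [full], an ideal inside [P1] is proper in [P1] exactly when it misses [a]; in this form [a] is
   visibly outside [Q]. *)
pose Q := [set x | exists I, [/\ ideal I, I `<=` P1, ~ I a & I x]].
have subQ I : ideal I -> I `<` P1 -> I `<=` Q.
  move=> iI [IP1 nP1I] x Ix; exists I; split=> // Ia.
  by apply: nP1I; have [-> _] := full I iI IP1 Ia; apply: subset_refl.
have LQ : L `<=` Q by apply: subQ.
have iQ : ideal Q.
  split; first by case: (iL) => [[x Lx] _]; exists x; apply: LQ.
  move=> x s [I [iI IP1 nIa Ix]].
  by split; exists I; split=> //; [apply: ideal_mulL | apply: ideal_mulR].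
have QP1 : Q `<` P1.
  split; first by move=> x [I [_ IP1 _ /IP1]].
  by move=> /(_ a P1a) [I []].
have P2Q : P2 `<` Q.
  split; first exact: subset_trans P2L.1 LQ.
  by move=> QP2; apply: P2L.2; apply: subset_trans LQ QP2.
have P1_sub x : ~ Q x -> P1 `<=` principal_ideal x.
  move=> nQx; have [P1x|nP1x] := pselect (P1 x); last first.
    move=> y /(compl_divides nP1x) [z _ ->].
    by exists 1, z; rewrite mul1g.
  apply: contrapT => nsub; apply/nQx/(subQ (principal_ideal x)).
  - exact: ideal_principal_ideal.
  - by split=> //; apply: principal_ideal_sub.
  - exact: principal_ideal_id.
have pQ : prime_ideal Q.
  split; first by apply: (sub_proper_ideal iQ QP1.1); case: hP1.
  (* Each element of [P1], being a product of two others, becomes [s * x * t * (u * y * v)]; its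
     middle part is in xSy, which would force [P1] into [Q]. *)
  move=> x y xyQ; apply: contrapT => /not_orP [/P1_sub xP1 /P1_sub yP1].
  apply: QP1.2; rewrite -P11 => _ [_ /xP1 [s [t ->]] [_ /yP1 [u [v ->]] <-]].
  rewrite !mulgA; apply: ideal_mulR => //; rewrite -!mulgA.
  apply: ideal_mulL => //; apply: xyQ.
  by exists (t * u); rewrite ?mulgA.
exists Q; split=> //.
  by move=> [I [iI [_ nIQ] IP1]]; apply: nIQ; apply: subQ.
case: (set_pow_omega_dichotomy iQ QP1.1 P2Q.2) => [->//|[QE _]].
by case: QP1.2; rewrite QE; apply: subset_refl.
Qed.

Lemma prime_segment_trichotomy :
  exactly_one (archimedean_segment P2 P1) (simple_segment P2 P1)
              (exceptional_segment P2 P1).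
Proof.
have nAE : archimedean_segment P2 P1 -> ~ exceptional_segment P2 P1.
  by move=> arch [Q [pQ [P2Q _] QP1 nQ _]]; apply: not_archimedean nQ arch.
have [simple|nsimple] := pselect (simple_segment P2 P1).
  apply: Or32; split=> //.
    (* Here [P2] itself plays the prime ideal [Q]. *)
    apply: not_archimedean simple => //.
    exact: completely_prime_ideal_prime.
  by move=> [Q [[[iQ _] _] P2Q QP1 _ _]]; apply: simple; exists Q.
have [arch|narch] := pselect (archimedean_segment P2 P1).
  by apply: Or31; split=> //; apply: nAE.
by apply: Or33; split=> //; apply: exceptional_of_not_simple_not_archimedean.
Qed.

End Comparable.

(** If [P2] is empty, no intersection of powers equals it, since ideals contain [szero]; only
    simplicity can hold, and it does exactly when [P1] is the zero ideal. Hence [hempty]. *)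
Theorem theorem4p8 (S : monoid0Type) (P1 P2 : set S)
    (hcancel : left_cancellative S)
    (hP1 : completely_prime_ideal P1)
    (hcomp : right_comparable P1)
    (hseg : prime_segment P2 P1)
    (hempty : P2 = set0 -> P1 = [set szero]) :
  exactly_one (archimedean_segment P2 P1)
              (simple_segment P2 P1)
              (exceptional_segment P2 P1).
Proof.
case: hseg => [[hP2 _ P21 nb]|[P20 _ _]].
  exact: prime_segment_trichotomy.
have P1E := hempty P20; subst P1 P2; apply: Or32.
have between (I : set S) : ideal I -> ~ I `<` [set szero].
  by move=> iI [_]; apply=> _ ->; apply: ideal_szero.
split=> [arch|[I [iI _ /(between I iI)]]//|[Q [[[iQ _] _] _ /(between Q iQ)]]//].
have [|I [iI _ _ E]] := arch szero; first by split=> // [].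
have : set_pow_omega I szero by apply: ideal_szero; apply: ideal_set_pow_omega.
by rewrite -E.
Qed.
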